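(* Let $H$ be a real Hilbert space, $C\subseteq H$ a nonempty, convex and closed set, and $F:H\to H$ an operator which is $\gamma$-strongly pseudo-monotone on $C$ with $\gamma>0$ and Lipschitz continuous with constant $L>0$. Let $0<\lambda<\frac1L$ and let $(\rho_n)_{n\ge0}\subseteq[1,2)$ with $\limsup_{n\to+\infty}\rho_n<2-\frac{2\lambda L}{1+\lambda L}$. Let $x_0\in H$ and let, for all $n\ge0$, $$y_n=P_C(x_n-\lambda F(x_n)),\qquad x_{n+1}=\rho_n\left(y_n+\lambda(F(x_n)-F(y_n))\right)+(1-\rho_n)x_n,$$ and assume that $x_n\ne y_n$ and $F(y_n)\neq0$ for every $n\ge0$. Then the sequence $(x_n)_{n\ge0}$ converges linearly to the unique solution $x^*$ of $\mathrm{VI}(F,C)$.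
   Context: $\mathrm{VI}(F,C)$ is the problem of finding $x^*\in C$ such that $\langle F(x^* ),x-x^*\rangle\ge 0$ for all $x\in C$. $P_C$ is the metric projection onto $C$. $F$ is $\gamma$-strongly pseudo-monotone on $C$ if for all $x,y\in C$: $\langle F(x),y-x\rangle\ge0\Rightarrow\langle F(y),y-x\rangle\ge\gamma\|x-y\|^2$. $F$ is Lipschitz continuous with constant $L$ if $\|F(x)-F(y)\|\le L\|x-y\|$ for all $x,y\in H$. It is known that under these assumptions $\mathrm{VI}(F,C)$ has a unique solution. ''$(x_n)$ converges linearly to $x^*$'' means that there exist $q\in(0,1)$ and $N\ge0$ with $\|x_{n+1}-x^*\|\le q\|x_n-x^*\|$ for all $n\ge N$. The iteration is Tseng's forward-backward-forward algorithm with relaxation parameters $(\rho_n)$; the algorithm stops if $y_n=x_n$ or $F(y_n)=0$, and the assumption that this never occurs means that it generates an infinite sequence. *)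

(* Defs.v *)
From HB Require Import structures.
From mathcomp Require Import all_boot all_order all_algebra.
From mathcomp Require Import all_classical all_reals all_analysis.

Set Implicit Arguments.
Unset Strict Implicit.
Unset Printing Implicit Defensive.

Import Order.TTheory GRing.Theory Num.Theory.
Import numFieldNormedType.Exports.

Local Open Scope classical_set_scope.
Local Open Scope ring_scope.

(* A real Hilbert space is a complete normed module H over a realType together
   with a positive definite symmetric bilinear form dot inducing its norm;
   {dot H for idfun} is such a form with no assumption relating it to `|_|. *)
Definition induces_norm (R : realType) (H : normedModType R)
    (dot : {dot H for idfun}) : Prop :=
  forall u : H, dot u u = `|u| ^+ 2.

Definition nearest_point (R : realType) (H : normedModType R) (C : set H)
    (z p : H) : Prop :=
  C p /\ forall c, C c -> `|z - p| <= `|z - c|.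

(* The value is junk (0) when z has no nearest point in C, which cannot happen
   for C nonempty, closed and convex in a Hilbert space. *)
Definition metric_proj (R : realType) (H : normedModType R) (C : set H)
    (z : H) : H :=
  xget 0 [set p | nearest_point C z p].

Definition VI_solution (R : realType) (H : normedModType R)
    (dot : {dot H for idfun}) (F : H -> H) (C : set H) (xs : H) : Prop :=
  C xs /\ forall x, C x -> 0 <= dot (F xs) (x - xs).

Definition strongly_pseudo_monotone (R : realType) (H : normedModType R)
    (dot : {dot H for idfun}) (gamma : R) (F : H -> H) (C : set H) : Prop :=
  forall x y, C x -> C y ->
    0 <= dot (F x) (y - x) -> gamma * `|x - y| ^+ 2 <= dot (F y) (y - x).

Definition converges_linearly (R : realType) (H : normedModType R)
    (x : nat -> H) (xs : H) : Prop :=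
  exists q : R, exists N : nat, 0 < q < 1 /\
    forall n, (N <= n)%N -> `|x n.+1 - xs| <= q * `|x n - xs|.

(* Main.v *)
(* Convergence: writing a = x - y and b = y - xs, the projection
   inequality at xs and strong pseudo-monotonicity give
     |x' - xs|^2 <= |x - xs|^2
       - rho (1 + lambda L) (2 - rho (1 + lambda L)) |a|^2
       - 2 rho lambda gamma |b|^2,
   and the limsup condition keeps 2 - rho (1 + lambda L) away from 0; since
   |x - xs|^2 <= 2 |a|^2 + 2 |b|^2 this is a contraction.

   Existence of a solution: by strong pseudo-monotonicity a solution lies, for
   every y in C, in the set {x | gamma |y - x|^2 <= <F y, y - x>}, which is a
   closed ball, and conversely (Minty) a point of C lying in all these balls is
   a solution. Finitely many balls meet on C because the problem restricted to
   the hull of finitely many points is solvable: this goes by induction on the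
   number of points, solving on each slice at height t of a cone with apex q and
   applying the intermediate value theorem in t. Closed balls meeting finitely
   often on a closed convex set of a Hilbert space have a common point, obtained
   as the limit of points of almost minimal norm. *)
Require Import Defs.
From HB Require Import structures.
From mathcomp Require Import all_boot all_order all_algebra.
From mathcomp Require Import all_classical all_reals all_analysis.
From mathcomp Require Import ring lra.

Set Implicit Arguments.
Unset Strict Implicit.
Unset Printing Implicit Defensive.

Import Order.TTheory GRing.Theory Num.Theory.
Import numFieldNormedType.Exports.

Local Open Scope classical_set_scope.
Local Open Scope ring_scope.

(** * Scalar limits and segments *)

(** Let [t] tend to 0. This ends the first-variation arguments below, where a quadratic remainder
    has been divided by [t]. *)
Lemma le0_of_le_mul (R : realFieldType) (a b : R) :
  (forall t, 0 < t <= 1 -> a <= t * b) -> a <= 0.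
Proof.
move=> le_tb; rewrite leNgt; apply/negP => a_gt0.
have := le_tb 1 ltac:(lra); rewrite mul1r => ab.
have b_gt0 : 0 < b by lra.
have /le_tb : 0 < a / (2 * b) <= 1.
  by rewrite divr_gt0 ?mulr_gt0 //= ler_pdivrMr ?mulr_gt0 //; lra.
have -> : a / (2 * b) * b = a / 2 by field; lra.
by lra.
Qed.

Lemma convex_set_segment (R : realType) (H : lmodType R) (C : set H) (x y : H)
    (t : R) :
  convex_set C -> C x -> C y -> 0 <= t <= 1 -> C (x + t *: (y - x)).
Proof.
move=> Ccvx Cx Cy t01.
case/andP: t01 => t0 t1; have := Ccvx y x (Itv01 t0 t1).
rewrite !inE => /(_ Cy Cx) Cxy.
suff -> : x + t *: (y - x) = t *: y + (1 - t) *: x by exact: Cxy.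
by rewrite scalerBr scalerBl scale1r addrCA.
Qed.

(** * Inner product and Cauchy-Schwarz *)

Section InnerProduct.
Context (R : realType) (H : normedModType R) (dot : {dot H for idfun}).

Lemma dotDl u v w : dot (u + v) w = dot u w + dot v w.
Proof. exact: linearDl. Qed.

Lemma dotDr u v w : dot w (u + v) = dot w u + dot w v.
Proof. exact: linearDr. Qed.

Lemma dotNl u w : dot (- u) w = - dot u w.
Proof. exact: linearNl. Qed.

Lemma dotNr u w : dot w (- u) = - dot w u.
Proof. exact: linearNr. Qed.

Lemma dotZl a u w : dot (a *: u) w = a * dot u w.
Proof. exact: linearZl_LR. Qed.

Lemma dotZr a u w : dot w (a *: u) = a * dot w u.
Proof. exact: linearZr_LR. Qed.

Lemma dotC u v : dot u v = dot v u.
Proof. by rewrite hermC expr0 mul1r. Qed.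

Definition dotE := (dotDl, dotDr, dotNl, dotNr, dotZl, dotZr).

Hypothesis dot_norm : induces_norm dot.

(** Reduces identities between vectors to scalar ones, which [ring] and [field] decide. *)
Lemma dot_inj u v : (forall w, dot u w = dot v w) -> u = v.
Proof.
move=> uv; apply/eqP; rewrite -subr_eq0 -normr_eq0 -sqrf_eq0 -dot_norm.
by rewrite dotDl dotNl uv subrr.
Qed.

(** Cauchy-Schwarz: expand the squared norm of [|v| u - |u| v] and divide by [|u| |v|]. *)
Lemma dot_le_norm u v : dot u v <= `|u| * `|v|.
Proof.
have u0 := normr_ge0 u; have v0 := normr_ge0 v.
have [uv0|uv_gt0] := leP (`|u| * `|v|) 0.
  have : (u == 0) || (v == 0).
    rewrite -(normr_eq0 u) -(normr_eq0 v) -mulf_eq0 eq_le uv0.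
    exact: mulr_ge0.
  by move=> /orP[] /eqP ->; rewrite ?linear0l ?linear0r ?normr0; lra.
have := sqr_ge0 `| `|v| *: u - `|u| *: v|.
rewrite -dot_norm !dotE !dot_norm (dotC v u) => ge0.
have : 0 <= (`|u| * `|v|) * (`|u| * `|v| - dot u v) by nra.
by rewrite pmulr_rge0 // subr_ge0.
Qed.

End InnerProduct.

(** * Intersections of closed balls and the metric projection *)

Section Projection.
Context (R : realType) (H : completeNormedModType R) (dot : {dot H for idfun}).
Hypothesis dot_norm : induces_norm dot.

Lemma parallelogram (u v : H) :
  `|u - v| ^+ 2 =
  2 * `|u| ^+ 2 + 2 * `|v| ^+ 2 - 4 * `|u + 2^-1 *: (v - u)| ^+ 2.
Proof. by rewrite -!dot_norm !dotE (dotC dot v u); field. Qed.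

Variables (C : set H).
Hypotheses (C_convex : convex_set C) (C_closed : closed C).

(** A substitute for weak compactness: by the parallelogram law, the points of nearly minimal norm
    in finite intersections form a Cauchy filter, and its limit lies in every ball. *)
Lemma closed_ball_family_meet (I : Type) (i0 : I) (c : I -> H) (r : I -> R) :
  (forall l : seq I, exists2 x, C x & all (fun i => `|c i - x| <= r i) l) ->
  exists2 x, C x & forall i, `|c i - x| <= r i.
Proof.
move=> fip; pose K l := [set x | C x /\ all (fun i => `|c i - x| <= r i) l].
have Kmid l x y : K l x -> K l y -> K l (x + 2^-1 *: (y - x)).
  move=> [Cx /all_nthP rx] [Cy /all_nthP ry]; split.
    by apply: convex_set_segment => //; lra.
  apply/(all_nthP i0) => j jl; have := rx i0 _ jl; have := ry i0 _ jl.
  set i := nth _ _ _ => yi xi.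
  have -> : c i - (x + 2^-1 *: (y - x)) =
      2^-1 *: (c i - x) + 2^-1 *: (c i - y).
    by apply: (dot_inj dot_norm) => w; rewrite !dotE; field.
  rewrite (le_trans (ler_normD _ _)) // !normrZ gtr0_norm ?invr_gt0 //; lra.
(* [S] collects the lower bounds for the norm on finite intersections. Its supremum [D] is finite
   because adding [i0] to a list confines the intersection to one ball. *)
pose S := [set d : R | exists l, forall x, K l x -> d <= `|x|].
have S0 : S 0 by exists [::] => x _; exact: normr_ge0.
have supS : has_sup S.
  split; first by exists 0.
  exists (`|c i0| + r i0) => d [l Kd].
  have [x Cx /= /andP[xi0 xl]] := fip (i0 :: l).
  rewrite (le_trans (Kd _ (conj Cx xl))) //.
  have -> : x = c i0 - (c i0 - x) by rewrite opprB addrC subrK.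
  by rewrite (le_trans (ler_normB _ _)) // lerD2l.
set D := sup S in supS *.
have D_ge0 : 0 <= D by exact: (ub_le_sup supS.2).
have near_min l e : 0 < e -> exists x, K l x /\ `|x| < D + e.
  move=> e_gt0; apply: contrapT => noK.
  have : D + e <= D.
    apply: (ub_le_sup supS.2); exists l => x Kx.
    by rewrite leNgt; apply/negP => xD; apply: noK; exists x.
  lra.
pose B (p : seq I * R) := [set x | K p.1 x /\ `|x| < D + p.2].
pose F := filter_from [set p : seq I * R | 0 < p.2] B.
have F_filter : ProperFilter F.
  apply: filter_from_proper; last by move=> [l e] /= /(near_min l).
  apply: filter_from_filter; first by exists ([::], 1) => /=.
  move=> [l e] [l' e'] /= e_gt0 e'_gt0; exists (l ++ l', Num.min e e') => /=.
    by rewrite lt_min e_gt0.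
  move=> x [[Cx]]; rewrite /= all_cat => /andP[xl xl'] xD.
  have := ge_min e e e'; have := ge_min e' e e'; rewrite !lexx orbT /= => h1 h2.
  by split; split => //=; lra.
have F_cauchy : cauchy F.
  apply/cauchyP => eps eps_gt0.
  (* With this [e], the bound [16 * e * (D + e)] for [|x - y| ^+ 2] is below [eps ^+ 2]. *)
  pose e := eps ^+ 2 / (16 * (D + eps + 1)).
  have den_gt0 : 0 < 16 * (D + eps + 1) by lra.
  have e_gt0 : 0 < e by rewrite divr_gt0 // exprn_gt0.
  have eE : e * (16 * (D + eps + 1)) = eps ^+ 2 by rewrite divfK // gt_eqF.
  have e_lt : e < eps + 1 by nra.
  (* On [K l] all norms exceed [D - e]; this applies to the midpoint of two nearly minimal
     points. *)
  have [d [l Kd] Dd] := sup_adherent e_gt0 supS.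
  have [x [Kx xD]] := near_min l e e_gt0.
  exists x; exists (l, e) => // y [/= Ky yD]; rewrite -ball_normE /ball_ /=.
  have /Kd := Kmid _ _ _ Kx Ky; rewrite -[sup S]/D in Dd => mid.
  have [x0 y0] := (normr_ge0 x, normr_ge0 y).
  have m0 := normr_ge0 (x + 2^-1 *: (y - x)).
  rewrite -(@ltr_pXn2r _ 2) ?nnegrE ?normr_ge0 ?ltW // parallelogram.
  set m := `|_ + _| in mid m0 *.
  have x2 : `|x| ^+ 2 <= (D + e) ^+ 2 by nra.
  have y2 : `|y| ^+ 2 <= (D + e) ^+ 2 by nra.
  have : 4 * (D + e) ^+ 2 - 4 * m ^+ 2 <= 16 * e * (D + e).
    (* If [D < e], then [D - e] is negative and cannot be squared, but [4 * (D + e) ^+ 2] alone is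
       small enough. *)
    by have [De|De] := leP e D; nra.
  nra.
have /cvg_ex[x Fx] : cvg F by exact: cauchy_cvg.
have inK (A : set H) l : closed A -> K l `<=` A -> A x.
  move=> A_closed KA; apply: (@closed_cvg _ _ F F_filter id A A_closed _ x Fx).
  by exists (l, 1) => //= y [/KA].
exists x; first by apply: (inK _ [::]) => // y [].
move=> i; apply: (inK (closed_ball_ Num.norm (c i) (r i)) [:: i]).
  exact: closed_closed_ball_.
by move=> y [_ /= /andP[]].
Qed.

Hypothesis C_neq0 : C !=set0.

(** Take the balls about [z] of radius [inf S + e] for all [e > 0]. Finitely many meet on [C] by
    definition of the infimum, and a common point of all attains the distance. *)
Lemma metric_projP (z : H) : nearest_point C z (metric_proj C z).
Proof.
rewrite /metric_proj; case: xgetP => [p -> //|none].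
pose S := [set `|z - c| | c in C].
have infS : has_inf S.
  split; first by have [c Cc] := C_neq0; exists `|z - c|, c.
  by exists 0 => _ [c _ <-]; exact: normr_ge0.
have [l|p Cp pz] := @closed_ball_family_meet {posnum R} 1%:pos (fun=> z)
    (fun e => inf S + e%:num).
  have [e le_e] : exists e : {posnum R}, all (fun i => e%:num <= i%:num) l.
    elim: l => [|i l [e le_e]]; first by exists 1%:pos.
    have [ei|/ltW ie] := leP e%:num i%:num; first by exists e; rewrite /= ei.
    by exists i; rewrite /= lexx; apply: sub_all le_e => j; exact: le_trans.
  have [_ [c Cc <-] zc] := inf_adherent (gt0 e) infS; exists c => //.
  by apply: sub_all le_e => i ei; rewrite (le_trans (ltW zc)) // lerD2l.
case: (none p); split=> // c Cc.
have pz0 : `|z - p| <= inf S.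
  by apply/ler_addgt0Pr => e e_gt0; exact: (pz (PosNum e_gt0)).
by rewrite (le_trans pz0) // ge_inf //; [case: infS | exists c].
Qed.

(** Compare the projection [p] with [p + t (c - p)], expand the squares, divide by [t] and let [t]
    tend to 0. *)
Lemma metric_proj_variational (z c : H) :
  C c -> dot (z - metric_proj C z) (c - metric_proj C z) <= 0.
Proof.
move=> Cc; have [] := metric_projP z; set p := metric_proj C z => Cp p_min.
rewrite -(@pmulr_rle0 _ 2) //; apply: (@le0_of_le_mul _ _ (`|c - p| ^+ 2)).
move=> t /andP[t_gt0 t_le1].
have /p_min : C (p + t *: (c - p)).
  by apply: convex_set_segment => //; rewrite ltW.
rewrite -(@ler_pXn2r _ 2) ?nnegrE ?normr_ge0 //.
have -> : z - (p + t *: (c - p)) = z - p - t *: (c - p) by rewrite opprD addrA.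
move: (z - p) (c - p) => u v; rewrite -!dot_norm !dotE (dotC dot v u) => le_uu.
by rewrite -(ler_pM2l t_gt0); lra.
Qed.

End Projection.

(** * Solvability on hulls of finitely many points *)

Lemma lipschitz_itv_continuous (R : realType) (f : R -> R) (a b K : R) :
  (forall x y, a <= x <= b -> a <= y <= b -> `|f x - f y| <= K * `|x - y|) ->
  {within `[a, b], continuous f}.
Proof.
move=> f_lip; apply/subspace_continuousP => x /=; rewrite in_itv /= => xab.
apply/cvgrPdist_lt => e e_gt0; rewrite near_withinE /=.
have K1_gt0 : 0 < `|K| + 1 by rewrite ltr_wpDl.
near=> y => /=; rewrite in_itv /= => yab.
have xy : `|x - y| < e / (`|K| + 1).
  by near: y; apply: (@nbhsx_ballx _ R); rewrite divr_gt0.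
rewrite ltr_pdivlMr // in xy.
have Kle := ler_norm K; have xy0 := normr_ge0 (x - y).
by have := f_lip _ _ xab yab; nra.
Unshelve. all: by end_near.
Qed.

Section Existence.
Context (R : realType) (H : normedModType R) (dot : {dot H for idfun}).
Hypothesis dot_norm : induces_norm dot.

(* All operators are allowed so that, in the induction on the hull, solvability
   on D applies to the slice operators d |-> F (d + t (q - d)). *)
Definition VI_solvable (D : set H) := forall (F : H -> H) (gamma L : R),
  0 < gamma -> 0 < L -> strongly_pseudo_monotone dot gamma F D ->
  (forall x y, `|F x - F y| <= L * `|x - y|) ->
  exists x, VI_solution dot F D x.

(** The cone over [D] with apex [q]; the height [t] is 0 on [D] and 1 at [q]. *)
Definition join_point (q : H) (D : set H) : set H :=
  [set z | exists d t, [/\ D d, 0 <= t <= 1 & z = d + t *: (q - d)]].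

Section JoinPoint.
Variables (D : set H) (q : H) (B : R).
Hypotheses (B_gt0 : 0 < B) (D_bound : forall d, D d -> `|q - d| <= B).
Variables (F : H -> H) (gamma L : R).
Hypotheses (gamma_gt0 : 0 < gamma) (L_gt0 : 0 < L).
Hypothesis F_spm : strongly_pseudo_monotone dot gamma F (join_point q D).
Hypothesis F_lip : forall x y, `|F x - F y| <= L * `|x - y|.

Local Notation pt d t := (d + t *: (q - d)).

Let pt_sub (d d' : H) (t : R) : pt d t - pt d' t = (1 - t) *: (d - d').
Proof. by apply: (dot_inj dot_norm) => w; rewrite !dotE; ring. Qed.

(** Differences within a slice carry a factor [1 - t], squared in the norm term and simple in the
    pairing, so one factor stays in the modulus. *)
Lemma slice_spm (t : R) : 0 <= t < 1 ->
  strongly_pseudo_monotone dot (gamma * (1 - t)) (fun d => F (pt d t)) D.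
Proof.
move=> /andP[t_ge0 t_lt1] x y Dx Dy mono.
have Dpt d : D d -> join_point q D (pt d t).
  by move=> Dd; exists d, t; split=> //; rewrite t_ge0 ltW.
have t1_gt0 : 0 < 1 - t by lra.
have := F_spm (Dpt _ Dx) (Dpt _ Dy); rewrite !pt_sub !dotZr normrZ gtr0_norm //.
rewrite pmulr_rge0 // => /(_ mono); rewrite exprMn => le_dot.
by rewrite -(ler_pM2l t1_gt0); lra.
Qed.

Definition slice_solution (s : R -> H) := forall t, 0 <= t < 1 ->
  VI_solution dot (fun d => F (pt d t)) D (s t).

Variable s : R -> H.
Hypothesis s_sol : slice_solution s.

(** Test each slice problem with the solution of the other, apply strong pseudo-monotonicity on
    slice [t'], and bound the change of [F] between the two heights at [s t]. *)
Let slice_solution_lipschitz (t t' : R) : 0 <= t < 1 -> 0 <= t' < 1 ->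
  gamma * (1 - t') * `|s t - s t'| <= L * B * `|t - t'|.
Proof.
move=> t01 t'01; have [Ds ssol] := s_sol t01; have [Ds' ssol'] := s_sol t'01.
have := slice_spm t'01 Ds' Ds (ssol' _ Ds); have := ssol _ Ds'.
rewrite -[s t' - s t]opprB dotNr normrN oppr_ge0 => le1 le2.
have := dot_le_norm dot_norm (F (pt (s t) t') - F (pt (s t) t)) (s t - s t').
have := F_lip (pt (s t) t') (pt (s t) t).
have -> : pt (s t) t' - pt (s t) t = (t' - t) *: (q - s t).
  by apply: (dot_inj dot_norm) => w; rewrite !dotE; ring.
rewrite normrZ (distrC t') => le3; rewrite dotDl dotNl => le4.
have := D_bound Ds; have := normr_ge0 (t - t').
have := normr_ge0 (s t - s t').
set u := `|s t - s t'| in le2 le4 *; set v := `|t - t'| in le3 *.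
move=> u_ge0 v_ge0 qB.
have [->|u_neq0] := eqVneq u 0; first by rewrite mulr0 !mulr_ge0 // ltW.
have u_gt0 : 0 < u by rewrite lt_def u_neq0.
have le5 : L * (v * `|q - s t|) <= L * B * v.
  by rewrite -mulrA ler_pM2l // mulrC ler_wpM2r.
rewrite -(ler_pM2r u_gt0); nra.
Qed.

(** Tests the slice solution in the direction of the apex, which the slice problem does not see. *)
Let h (t : R) := dot (F (pt (s t) t)) (q - s t).

(** The constant blows up as [t1] tends to 1, where the modulus of the slice problems
    degenerates. *)
Let h_lipschitz (t1 : R) : t1 < 1 -> exists K : R,
  forall t t' : R, 0 <= t <= t1 ->
  0 <= t' <= t1 -> `|h t - h t'| <= K * `|t - t'|.
Proof.
move=> t1_lt1.
have gt1_gt0 : 0 < gamma * (1 - t1) by rewrite mulr_gt0 ?subr_gt0.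
pose M := `|F q| + L * B; pose Q := L * B / (gamma * (1 - t1)).
have Q_ge0 : 0 <= Q by rewrite !mulr_ge0 ?invr_ge0 // ltW.
exists (L * (Q + B) * B + M * Q).
suff main t t' : 0 <= t <= t1 -> 0 <= t' <= t1 ->
    h t - h t' <= (L * (Q + B) * B + M * Q) * `|t - t'|.
  move=> t t' tt1 t't1; rewrite ler_norml lerNl opprB main // andbT.
  by rewrite (distrC t) main.
move=> tt1 t't1.
have t01 : 0 <= t < 1 by lra.
have t'01 : 0 <= t' < 1 by lra.
have [Ds _] := s_sol t01; have [Ds' _] := s_sol t'01.
have ss : `|s t - s t'| <= Q * `|t - t'|.
  rewrite mulrAC ler_pdivlMr // mulrC.
  apply: le_trans (slice_solution_lipschitz t01 t'01).
  by rewrite ler_wpM2r ?normr_ge0 // ler_pM2l //; lra.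
have ww : `|pt (s t) t - pt (s t') t'| <= (Q + B) * `|t - t'|.
  have -> : pt (s t) t - pt (s t') t' =
      (1 - t) *: (s t - s t') + (t - t') *: (q - s t').
    by apply: (dot_inj dot_norm) => w; rewrite !dotE; ring.
  rewrite (le_trans (ler_normD _ _)) // mulrDl !normrZ lerD //.
    rewrite ger0_norm; last by lra.
    by rewrite (le_trans _ ss) // ler_piMl //; lra.
  by rewrite mulrC ler_wpM2r ?normr_ge0 // D_bound.
have FwM : `|F (pt (s t') t')| <= M.
  have -> : F (pt (s t') t') = F q + (F (pt (s t') t') - F q).
    by rewrite [RHS]addrC subrK.
  rewrite (le_trans (ler_normD _ _)) // lerD2l.
  rewrite (le_trans (F_lip _ _)) // ler_pM2l //.
  have -> : pt (s t') t' - q = (t' - 1) *: (q - s t').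
    by apply: (dot_inj dot_norm) => w; rewrite !dotE; ring.
  rewrite normrZ ler0_norm; last by lra.
  by rewrite (le_trans _ (D_bound Ds')) // ler_piMl //; lra.
have -> : h t - h t' = dot (F (pt (s t) t) - F (pt (s t') t')) (q - s t) +
    dot (F (pt (s t') t')) (s t' - s t).
  by rewrite /h !(dotDl, dotDr, dotNl, dotNr); ring.
rewrite mulrDl lerD // (le_trans (dot_le_norm dot_norm _ _)) //.
  rewrite mulrAC ler_pM ?normr_ge0 ?D_bound //.
  by rewrite (le_trans (F_lip _ _)) // -mulrA ler_pM2l.
by rewrite -mulrA ler_pM ?normr_ge0 // distrC.
Qed.

(* A zero of h turns the solution on its slice into a solution on the whole
   cone; if h has no zero, then the slice t = 0 or the apex q is a solution. *)
Lemma VI_join_point : exists x, VI_solution dot F (join_point q D) x.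
Proof.
have s0 : 0 <= (0 : R) < 1 by rewrite lexx ltr01.
have in_join d t : D d -> 0 <= t <= 1 -> join_point q D (pt d t).
  by move=> Dd t01; exists d, t.
have [q_sol|] := pselect (forall d, D d -> 0 <= dot (F q) (d - q)).
  have [Ds _] := s_sol s0; exists q; split.
    exists (s 0), 1; split=> //; first by rewrite ler01 lexx.
    by rewrite scale1r addrC subrK.
  move=> _ [d [t [Dd /andP[t_ge0 t_le1] ->]]].
  have -> : pt d t - q = (1 - t) *: (d - q).
    by apply: (dot_inj dot_norm) => w; rewrite !dotE; ring.
  by rewrite dotZr mulr_ge0 ?subr_ge0 // q_sol.
move=> /existsNP[d0 /not_implyP[Dd0 /negP]]; rewrite -ltNge => q_d0.
pose delta := dot (F q) (q - d0).
have delta_gt0 : 0 < delta by rewrite /delta -opprB dotNr oppr_gt0.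
(* At this height [F] has changed from [F q] by at most [delta] when paired with [q - d0], which
   forces [h t1 >= 0]. The minimum with 1 keeps [t1 >= 0]. *)
pose t1 := 1 - Num.min 1 (delta / (L * B * B)).
have LBB_gt0 : 0 < L * B * B by rewrite !mulr_gt0.
have [t1_ge0 t1_lt1] : 0 <= t1 /\ t1 < 1.
  by rewrite /t1 subr_ge0 ge_min lexx gtrBl lt_min ltr01 divr_gt0.
have t1_delta : L * B * B * (1 - t1) <= delta.
  rewrite /t1 opprB addrC subrK mulrC -ler_pdivlMr // ge_min lexx orbT //.
have t1_01 : 0 <= t1 < 1 by rewrite t1_ge0.
have h1_ge0 : 0 <= h t1.
  have [Ds /(_ _ Dd0) sol] := s_sol t1_01.
  have := dot_le_norm dot_norm (F q - F (pt (s t1) t1)) (q - d0).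
  have := F_lip q (pt (s t1) t1).
  have -> : q - pt (s t1) t1 = (1 - t1) *: (q - s t1).
    by apply: (dot_inj dot_norm) => w; rewrite !dotE; ring.
  rewrite normrZ gtr0_norm ?subr_gt0 // dotDl dotNl -/delta => le1 le2.
  have le3 : `|F q - F (pt (s t1) t1)| * `|q - d0| <= L * B * B * (1 - t1).
    have -> : L * B * B * (1 - t1) = (L * ((1 - t1) * B)) * B by ring.
    rewrite ler_pM ?normr_ge0 ?D_bound // (le_trans le1) // ler_pM2l //.
    by rewrite ler_pM2l ?subr_gt0 // D_bound.
  have : h t1 = dot (F (pt (s t1) t1)) (q - d0) +
      dot (F (pt (s t1) t1)) (d0 - s t1).
    by rewrite /h -dotDr addrA subrK.
  by lra.
(* A displacement in the cone splits into a slice part, handled by [s c], and [t - c] times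
   [q - s c], which contributes [(t - c) * h c]. *)
have solves c : 0 <= c < 1 -> (forall t, 0 <= t <= 1 -> 0 <= (t - c) * h c) ->
    exists x, VI_solution dot F (join_point q D) x.
  move=> c01 hc; have [Ds sol] := s_sol c01.
  exists (pt (s c) c); split; first by apply: in_join => //; lra.
  move=> _ [d [t [Dd t01 ->]]].
  have -> : pt d t - pt (s c) c = (1 - t) *: (d - s c) + (t - c) *: (q - s c).
    by apply: (dot_inj dot_norm) => w; rewrite !dotE; ring.
  rewrite dotDr !dotZr addr_ge0 ?hc // mulr_ge0 ?sol //; lra.
have [h0_ge0|h0_lt0] := leP 0 (h 0).
  by apply: (solves 0) => // t t01; rewrite subr0 mulr_ge0 //; lra.
have [K h_lip] := h_lipschitz t1_lt1.
have [|c] := @IVT R h 0 t1 0 t1_ge0 (lipschitz_itv_continuous h_lip).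
  by rewrite ge_min le_max (ltW h0_lt0) h1_ge0 orbT.
rewrite in_itv /= => /andP[c_ge0 c_t1] hc0.
apply: (solves c); first by rewrite c_ge0 (le_lt_trans c_t1).
by move=> t _; rewrite hc0 mulr0.
Qed.

End JoinPoint.

Lemma VI_solvable_join_point (D : set H) (q : H) (B : R) :
  (forall d, D d -> `|q - d| <= B) -> VI_solvable D ->
  VI_solvable (join_point q D).
Proof.
move=> D_bound D_sol F gamma L gamma_gt0 L_gt0 F_spm F_lip.
have B1_gt0 : 0 < Num.max 1 B by rewrite lt_max ltr01.
have DB d : D d -> `|q - d| <= Num.max 1 B.
  by move=> /D_bound dB; rewrite le_max dB orbT.
(* Heights outside [[0, 1)] get the junk value 0. *)
have /choice[s s_sol] (t : R) : exists x, 0 <= t < 1 ->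
    VI_solution dot (fun d => F (d + t *: (q - d))) D x.
  have [t01|_] := boolP (0 <= t < 1); last by exists 0.
  have gt_gt0 : 0 < gamma * (1 - t) by rewrite mulr_gt0 // subr_gt0; lra.
  have [x y|x x_sol] := D_sol _ _ L gt_gt0 L_gt0 (slice_spm F_spm t01).
    rewrite (le_trans (F_lip _ _)) // ler_pM2l //.
    have -> : x + t *: (q - x) - (y + t *: (q - y)) = (1 - t) *: (x - y).
      by apply: (dot_inj dot_norm) => w; rewrite !dotE; ring.
    by rewrite normrZ ger0_norm ?ler_piMl //; lra.
  by exists x.
exact: (@VI_join_point _ _ _ B1_gt0 DB _ _ _ gamma_gt0 L_gt0 F_spm F_lip s).
Qed.

(** Iterated cones, one point at a time, so that solvability follows by induction on the list. *)
Definition hull (p : H) (l : seq H) : set H := foldr join_point [set p] l.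

Lemma hull_bounded p l : exists B, forall d, hull p l d -> `|d| <= B.
Proof.
elim: l => [|q l [B lB]]; first by exists `|p| => _ ->.
exists (B + `|q|) => _ [d [t [/lB dB /andP[t_ge0 t_le1] ->]]].
have -> : d + t *: (q - d) = (1 - t) *: d + t *: q.
  by apply: (dot_inj dot_norm) => w; rewrite !dotE; ring.
rewrite (le_trans (ler_normD _ _)) // !normrZ !ger0_norm ?subr_ge0 //.
have := normr_ge0 d; have := normr_ge0 q; nra.
Qed.

Lemma hull_solvable p l : VI_solvable (hull p l).
Proof.
elim: l => [|q l sol].
  move=> F gamma L _ _ _ _; exists p; split=> // _ ->.
  by rewrite subrr linear0r.
have [B lB] := hull_bounded p l.
apply: (@VI_solvable_join_point _ _ (`|q| + B)) => // d /lB dB.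
by rewrite (le_trans (ler_normB _ _)) // lerD2l.
Qed.

Lemma hull_base p l : hull p l p.
Proof.
elim: l => //= q l lp; exists p, 0.
by split=> //; rewrite ?scale0r ?addr0 // lexx ler01.
Qed.

Lemma hull_mem p l q : q \in l -> hull p l q.
Proof.
elim: l => //= q' l lq; rewrite inE => /orP[/eqP ->|/lq lq'].
  exists p, 1; split; [exact: hull_base | by rewrite ler01 lexx |].
  by rewrite scale1r addrC subrK.
by exists q, 0; split=> //; rewrite ?scale0r ?addr0 // lexx ler01.
Qed.

Lemma hull_sub (C : set H) p l : convex_set C -> C p ->
  (forall q, q \in l -> C q) -> hull p l `<=` C.
Proof.
move=> C_convex Cp; elim: l => [_ _ -> //|q l IH lC] _ [d [t [/IH Cd t01 ->]]].
apply: convex_set_segment => //; last by apply: lC; exact: mem_head.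
by apply: Cd => x xl; apply: lC; rewrite inE xl orbT.
Qed.

End Existence.

(** * Existence and uniqueness of the solution on [C] *)

Section VI.
Context (R : realType) (H : completeNormedModType R) (dot : {dot H for idfun}).
Hypothesis dot_norm : induces_norm dot.
Variables (C : set H).
Hypotheses (C_convex : convex_set C).
Variables (F : H -> H) (gamma L : R).
Hypotheses (gamma_gt0 : 0 < gamma) (L_gt0 : 0 < L).
Hypothesis F_spm : strongly_pseudo_monotone dot gamma F C.
Hypothesis F_lip : forall x y, `|F x - F y| <= L * `|x - y|.

(** Test with [x + t (y - x)], divide by [t], and replace [F] there by [F x] at a cost of order
    [t]. *)
Lemma VI_solution_minty x : C x ->
  (forall y, C y -> 0 <= dot (F y) (y - x)) -> VI_solution dot F C x.
Proof.
move=> Cx minty; split=> // y Cy; rewrite -oppr_le0.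
apply: (@le0_of_le_mul _ _ (L * `|y - x| * `|y - x|)) => t /andP[t_gt0 t_le1].
have /minty : C (x + t *: (y - x)).
  by apply: convex_set_segment => //; rewrite ltW.
have xE : x + t *: (y - x) - x = t *: (y - x) by rewrite [LHS]addrC addKr.
rewrite xE dotZr pmulr_rge0 // => ge0.
have := dot_le_norm dot_norm (F (x + t *: (y - x)) - F x) (y - x).
have := F_lip (x + t *: (y - x)) x.
rewrite xE normrZ gtr0_norm // dotDl dotNl.
have := normr_ge0 (y - x); nra.
Qed.

Lemma VI_solution_unique x y :
  VI_solution dot F C x -> VI_solution dot F C y -> x = y.
Proof.
move=> [Cx xsol] [Cy ysol]; have := ysol _ Cx.
have := F_spm Cx Cy (xsol _ Cy); rewrite -[x - y]opprB dotNr normrN => le1 le2.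
have : `|y - x| ^+ 2 <= 0 by rewrite -(pmulr_rle0 _ gamma_gt0); lra.
by rewrite exprn_even_le0 //= normr_eq0 subr_eq0 => /eqP ->.
Qed.

Hypotheses (C_neq0 : C !=set0) (C_closed : closed C).

Lemma VI_solution_exists : exists x, VI_solution dot F C x.
Proof.
have [p Cp] := C_neq0.
(* Centre and radius of the ball of all [x] with [gamma |y - x|^2 <= <F y, y - x>]. *)
pose c (y : {y | C y}) := sval y - (2 * gamma)^-1 *: F (sval y).
pose r (y : {y | C y}) := (2 * gamma)^-1 * `|F (sval y)|.
(* Completing the square. *)
have in_ball y x : (`|c y - x| <= r y) =
    (gamma * `|sval y - x| ^+ 2 <= dot (F (sval y)) (sval y - x)).
  have -> : c y - x = (sval y - x) - (2 * gamma)^-1 *: F (sval y).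
    by rewrite /c addrAC.
  rewrite /r; move: (F (sval y)) (sval y - x) => f u.
  have k_gt0 : 0 < (2 * gamma)^-1 by rewrite invr_gt0 mulr_gt0.
  have kgE v : 2 * ((2 * gamma)^-1 * (gamma * v)) = v by field; rewrite gt_eqF.
  have kf_ge0 : 0 <= (2 * gamma)^-1 * `|f| by rewrite mulr_ge0 // ltW.
  rewrite -[RHS](ler_pM2l k_gt0) -[LHS](@ler_pXn2r _ 2) ?nnegrE ?normr_ge0 //.
  rewrite exprMn -!dot_norm !dotE (dotC dot u f).
  have := kgE (dot u u); set k := (2 * gamma)^-1 => kgu.
  by apply/idP/idP => le_dot; lra.
have [l|x Cx x_ball] := closed_ball_family_meet dot_norm C_convex C_closed
    (exist _ p Cp) (c := c) (r := r).
  pose D := hull p (map sval l).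
  have DC : D `<=` C.
    apply: hull_sub => // q; elim: (l) => //= y l' lC.
    by rewrite inE => /orP[/eqP -> | /lC //]; exact: (svalP y).
  have D_spm : strongly_pseudo_monotone dot gamma F D.
    by move=> x y /DC Cx /DC; exact: F_spm.
  (* A solution on the hull lies in the ball of each listed point, by strong pseudo-monotonicity. *)
  have [x [Dx xsol]] := hull_solvable dot_norm gamma_gt0 L_gt0 D_spm F_lip.
  exists x; first exact: DC.
  apply/(all_nthP (exist _ p Cp)) => j jl.
  have yl : sval (nth (exist _ p Cp) l j) \in map sval l.
    by rewrite -(nth_map _ p) // mem_nth ?size_map.
  rewrite in_ball distrC; apply: F_spm; [exact: DC | exact: svalP |].
  by apply/xsol/hull_mem.
exists x; apply: VI_solution_minty => // y Cy.
have := x_ball (exist _ y Cy); rewrite in_ball /=; apply: le_trans.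
by rewrite mulr_ge0 ?exprn_ge0 // ltW.
Qed.

End VI.

(** * The limsup condition and one step of the algorithm *)

Lemma limn_sup_lt (R : realType) (u : R^nat) (a b r : R) :
  (forall n, a <= u n <= b) -> limn_sup u < r ->
  exists N, forall n, (N <= n)%N -> u n < r.
Proof.
move=> u_ab.
have u_ub : has_ubound (range u).
  by exists b => _ [n _ <-]; case/andP: (u_ab n).
have u_lb : has_lbound (range u).
  by exists a => _ [n _ <-]; case/andP: (u_ab n).
have ub_sdrop n : has_ubound (sdrop u n).
  by exists b => _ [m _ <-]; case/andP: (u_ab m).
have le_sups n m : (n <= m)%N -> u m <= sups u n.
  by move=> nm; apply: ub_le_sup => //; exists m.
(* By boundedness the limsup is the infimum of the tail suprema, so some tail supremum is below
   [r]. *)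
have -> : limn_sup u = inf (range (sups u)) by exact/cvg_lim/cvg_sups_inf.
rewrite -subr_gt0 => r_gt.
have [|_ [N _ <-]] := inf_adherent r_gt (E := range (sups u)).
  split; first by exists (sups u 0%N), 0%N.
  exists a => _ [n _ <-]; rewrite (le_trans _ (le_sups n n _)) //.
  by case/andP: (u_ab n).
by rewrite addrC subrK => supsN; exists N => n /le_sups/le_lt_trans ->.
Qed.

Section Tseng.
Context (R : realType) (H : normedModType R) (dot : {dot H for idfun}).
Hypothesis dot_norm : induces_norm dot.
Variables (C : set H) (F : H -> H) (gamma L lambda : R).
Hypotheses (L_gt0 : 0 < L) (lambda_gt0 : 0 < lambda).
Hypothesis F_spm : strongly_pseudo_monotone dot gamma F C.
Hypothesis F_lip : forall x y, `|F x - F y| <= L * `|x - y|.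

Lemma tseng_step (rho : R) (x y xs : H) : 1 <= rho -> C y ->
  (forall c, C c -> dot (x - lambda *: F x - y) (c - y) <= 0) ->
  VI_solution dot F C xs ->
  `|rho *: (y + lambda *: (F x - F y)) + (1 - rho) *: x - xs| ^+ 2 <=
  `|x - xs| ^+ 2
  - rho * (1 + lambda * L) * (2 - rho * (1 + lambda * L)) * `|x - y| ^+ 2
  - 2 * rho * lambda * gamma * `|y - xs| ^+ 2.
Proof.
move=> rho_ge1 Cy proj [Cxs xs_sol].
have := F_spm Cxs Cy (xs_sol _ Cy); have := proj _ Cxs; have := F_lip x y.
have := dot_le_norm dot_norm (- (x - y)) (F x - F y); rewrite dotNl normrN.
rewrite (distrC xs y).
have -> : x - lambda *: F x - y = (x - y) - lambda *: (F x - F y + F y).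
  by rewrite subrK addrAC.
have -> : xs - y = - (y - xs) by rewrite opprB.
have -> : rho *: (y + lambda *: (F x - F y)) + (1 - rho) *: x - xs =
    (y - xs) + (1 - rho) *: (x - y) + (rho * lambda) *: (F x - F y).
  by apply: (dot_inj dot_norm) => w; rewrite !dotE; ring.
have -> : x - xs = (x - y) + (y - xs) by rewrite addrA subrK.
set d := (_ - F y); move: (x - y) (y - xs) d (F y) => a b d f ad d_le ab fb.
have a_ge0 := normr_ge0 a; have d_ge0 := normr_ge0 d.
have dd : `|d| ^+ 2 <= L ^+ 2 * `|a| ^+ 2.
  have La_ge0 : 0 <= L * `|a| by rewrite mulr_ge0 // ltW.
  by rewrite -exprMn ler_sqr ?nnegrE.
have {}ad : - dot a d <= L * `|a| ^+ 2.
  by rewrite (le_trans ad) // expr2 mulrCA ler_wpM2l.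
move: ab; rewrite -!dot_norm in dd ad fb *.
rewrite !dotE (dotC dot b a) (dotC dot d a) (dotC dot b d) => ab.
have l_gt0 := lambda_gt0.
(* The right side minus the left is exactly [2 h1 + 2 h2 + h3 + 2 h4], naming each term by its
   bound: projection inequality, pseudo-monotonicity, Lipschitz bound, and Cauchy-Schwarz with
   [rho >= 1]. *)
have h1 : 0 <= rho * (dot a b - lambda * dot d b - lambda * dot f b).
  by apply: mulr_ge0; lra.
have h2 : 0 <= rho * lambda * (dot f b - gamma * dot b b).
  by apply: mulr_ge0; [apply: mulr_ge0|]; lra.
have h3 : 0 <= rho ^+ 2 * lambda ^+ 2 * (L ^+ 2 * dot a a - dot d d).
  by apply: mulr_ge0; [apply: mulr_ge0; exact: sqr_ge0 | lra].
have h4 : 0 <= rho * (rho - 1) * lambda * (L * dot a a + dot a d).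
  by do 2?[apply: mulr_ge0]; [apply: mulr_ge0|..]; lra.
lra.
Qed.

(** Since [rho] and [1 + lambda * L] are at least 1, both decrements have coefficient at least [m],
    and [|x - xs|^2 <= 2 |x - y|^2 + 2 |y - xs|^2] turns them into [m / 2] times [|x - xs|^2]. *)
Lemma tseng_contraction (rho e : R) (x y xs : H) : 1 <= rho -> C y ->
  (forall c, C c -> dot (x - lambda *: F x - y) (c - y) <= 0) ->
  VI_solution dot F C xs -> 0 < gamma -> 0 < e ->
  e <= 2 - rho * (1 + lambda * L) ->
  `|rho *: (y + lambda *: (F x - F y)) + (1 - rho) *: x - xs| ^+ 2 <=
  (1 - Num.min e (2 * lambda * gamma) / 2) * `|x - xs| ^+ 2.
Proof.
move=> rho_ge1 Cy proj xs_sol gamma_gt0 e_gt0 e_le.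
apply: (le_trans (tseng_step rho_ge1 Cy proj xs_sol)).
set m := Num.min _ _.
have me : m <= e by rewrite ge_min lexx.
have ml : m <= 2 * lambda * gamma by rewrite ge_min lexx orbT.
have m_gt0 : 0 < m by rewrite lt_min e_gt0 !mulr_gt0.
have : `|x - xs| ^+ 2 <= 2 * `|x - y| ^+ 2 + 2 * `|y - xs| ^+ 2.
  have -> : x - xs = (x - y) + (y - xs) by rewrite addrA subrK.
  have := sqr_ge0 `|x - y - (y - xs)|; move: (x - y) (y - xs) => a b.
  by rewrite -!dot_norm !dotE (dotC dot b a); lra.
have := sqr_ge0 `|x - y|; have := sqr_ge0 `|y - xs|.
move: (`|x - xs| ^+ 2) (`|x - y| ^+ 2) (`|y - xs| ^+ 2) => X A B.
move=> B_ge0 A_ge0 XAB.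
have lL_gt0 : 0 < lambda * L by rewrite mulr_gt0.
have h1 : m * A <= rho * (1 + lambda * L) * (2 - rho * (1 + lambda * L)) * A.
  rewrite ler_wpM2r // (le_trans me) // (le_trans e_le) // ler_peMl //.
    lra.
  nra.
have h2 : m * B <= 2 * rho * lambda * gamma * B.
  rewrite ler_wpM2r // (le_trans ml) //.
  have : 0 <= (rho - 1) * (lambda * gamma).
    by rewrite mulr_ge0 ?subr_ge0 // mulr_ge0 ?ltW.
  lra.
have h3 : 0 <= m * (2 * A + 2 * B - X) by rewrite mulr_ge0 ?subr_ge0 // ltW.
lra.
Qed.

End Tseng.

(** * Linear convergence of the iteration *)

Theorem theorem3p5 (R : realType) (H : completeNormedModType R)
    (dot : {dot H for idfun}) (dot_norm : induces_norm dot)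
    (C : set H) (C_neq0 : C !=set0) (C_convex : convex_set C)
    (C_closed : closed C)
    (F : H -> H) (gamma L : R) (gamma_gt0 : 0 < gamma) (L_gt0 : 0 < L)
    (F_spm : strongly_pseudo_monotone dot gamma F C)
    (F_lip : L.-lipschitz F)
    (lambda : R) (lambda_gt0 : 0 < lambda) (lambda_lt : lambda < 1 / L)
    (rho : nat -> R) (rho_itv : forall n, 1 <= rho n < 2)
    (rho_limsup :
      limn_sup rho < 2 - 2 * lambda * L / (1 + lambda * L))
    (x y : nat -> H)
    (y_def : forall n, y n = metric_proj C (x n - lambda *: F (x n)))
    (x_def : forall n, x n.+1 =
      rho n *: (y n + lambda *: (F (x n) - F (y n))) + (1 - rho n) *: x n)
    (x_neq_y : forall n, x n <> y n) (Fy_neq0 : forall n, F (y n) <> 0) :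
  exists xs : H, unique (VI_solution dot F C) xs /\ converges_linearly x xs.
Proof.
have F_lip' u v : `|F u - F v| <= L * `|u - v| by exact: (F_lip (u, v)).
have [xs xs_sol] := VI_solution_exists dot_norm C_convex gamma_gt0 L_gt0 F_spm
  F_lip' C_neq0 C_closed.
exists xs; split.
  by split=> // z; exact: (VI_solution_unique gamma_gt0 F_spm xs_sol).
have lL_gt0 : 0 < 1 + lambda * L by rewrite addr_gt0 // mulr_gt0.
(* The midpoint of the limsup and its bound, which equals [2 / (1 + lambda * L)]. Hence eventually
   [rho n < r], and [e] below is positive. *)
pose r := (limn_sup rho + (2 - 2 * lambda * L / (1 + lambda * L))) / 2.
have r_lt : r < 2 - 2 * lambda * L / (1 + lambda * L) by rewrite /r; lra.
have [||N rhoN] := @limn_sup_lt R rho 1 2 r.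
- by move=> n; have := rho_itv n; lra.
- by rewrite /r; lra.
pose e := 2 - r * (1 + lambda * L).
have e_gt0 : 0 < e.
  rewrite subr_gt0 -ltr_pdivlMr // (lt_le_trans r_lt) //.
  by rewrite le_eqVlt; apply/orP; left; apply/eqP; field; lra.
pose m := Num.min e (2 * lambda * gamma).
have m_gt0 : 0 < m by rewrite lt_min e_gt0 !mulr_gt0.
(* The factor for squared distances; the maximum with 1/2 keeps it positive when [m >= 2]. The
   linear rate is its square root. *)
pose q2 := Num.max 2^-1 (1 - m / 2).
have q2_gt0 : 0 < q2 by rewrite lt_max invr_gt0 ltr0n.
have q2_lt1 : q2 < 1 by rewrite gt_max; lra.
exists (Num.sqrt q2), N; split.
  by rewrite sqrtr_gt0 q2_gt0 -sqrtr1 ltr_sqrt.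
move=> n Nn.
have [Cy _] := metric_projP dot_norm C_convex C_closed C_neq0
  (x n - lambda *: F (x n)).
have proj := @metric_proj_variational _ _ _ dot_norm _ C_convex C_closed C_neq0
  (x n - lambda *: F (x n)).
rewrite -y_def in Cy proj.
have [rho_ge1 _] := andP (rho_itv n).
have e_le : e <= 2 - rho n * (1 + lambda * L).
  by rewrite lerD2l lerN2 ler_pM2r // ltW // rhoN.
have := tseng_contraction dot_norm L_gt0 lambda_gt0 F_spm F_lip' rho_ge1 Cy proj
  xs_sol gamma_gt0 e_gt0 e_le.
rewrite -x_def -/m => step.
rewrite -(@ler_pXn2r _ 2) ?nnegrE ?mulr_ge0 ?sqrtr_ge0 ?normr_ge0 //.
rewrite exprMn sqr_sqrtr ?(ltW q2_gt0) // (le_trans step) //.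
by rewrite ler_wpM2r ?sqr_ge0 // le_max lexx orbT.
Qed.
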